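(* Let $k\ge2$ and let $G_1$ be a graph on $k$ vertices whose complement is the cycle $C_k$ (for $k=2$, $C_2$ is the complete graph on $2$ vertices). For $d\ge2$ let $H$ be the join of $d$ copies of $G_1$ (on disjoint vertex sets). Then for $i\ge1$, $$\beta_{i,i+1}(H)=\binom{dk}{i+1}\frac{i(dk-i-2)}{dk-1}+d\binom{(d-1)k}{i-k+1},$$ and $\beta_{i,i+2}(H)=d\binom{(d-1)k}{i-k+2}$ if $k\ge4$, while $\beta_{i,i+2}(H)=0$ if $k\in\{2,3\}$.
   Context: The join $G*H$ of graphs with disjoint vertex sets has all edges of $G$, of $H$, and all pairs $\{x,y\}$ with $x\in V(G)$, $y\in V(H)$. For a finite simple graph $G$ on vertex set $V$, $R=\mathbb{K}[x_v:v\in V]$ over a fixed field $\mathbb{K}$, $I(G)=\langle x_ux_v:\{u,v\}\in E(G)\rangle$, and $\beta_{i,d}(G)=\beta_{i,d}(R/I(G))$ is the graded Betti number. Binomial coefficients $\binom{a}{b}$ are $0$ if $b<0$ or $b>a$. *)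

(* Defs.v *)
From HB Require Import structures.
From mathcomp Require Import all_boot all_order all_algebra.
Set Implicit Arguments. Unset Strict Implicit. Unset Printing Implicit Defensive.
Import GRing.Theory Num.Theory.

(* Graded Betti numbers of R/I(G), computed as
   dim_K Tor_i^R(R/I(G), K)_d via the Koszul complex K(x; R/I(G)),
   decomposed into its finite-dimensional N^V-graded (multidegree) pieces. *)

Section Betti.
Variables (K : fieldType) (V : finType) (E : rel V).

(* x^m is NOT in the edge ideal I(G) iff supp(m) contains no edge *)
Definition notin_edge_ideal (m : V -> nat) : bool :=
  [forall u, forall v, E u v ==> ~~ ((0 < m u) && (0 < m v))].

(* Basis of the multidegree-a piece of K_i(x; R/I): the elements
   x^(a - 1_F) (x) e_F with |F| = i, F within supp a, x^(a-1_F) nonzero in R/I. *)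
Definition kbasis (a : V -> nat) (i : nat) : {set {set V}} :=
  [set F : {set V} | [&& #|F| == i, [forall v in F, 0 < a v] &
       notin_edge_ideal (fun v => a v - (v \in F))]].

Definition kpos (F : {set V}) (v : V) : nat :=
  #|[set u in F | enum_rank u < enum_rank v]|.

(* Koszul differential  e_F |-> sum_{v in F} (-1)^{pos} x_v e_{F\v} *)
Definition kdiff_entry (a : V -> nat) (i : nat) (F F' : {set V}) : K :=
  if [&& F \in kbasis a i, F' \in kbasis a i.-1 & F' \subset F]
  then (\sum_(v in F :\: F') (-1) ^+ kpos F v)%R else 0%R.

Definition kdiff (a : V -> nat) (i : nat) : 'M[K]_(#|{set V}|) :=
  \matrix_(r, c) kdiff_entry a i (enum_val r) (enum_val c).

Definition khom (a : V -> nat) (i : nat) : nat :=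
  #|kbasis a i| - \rank (kdiff a i) - \rank (kdiff a i.+1).

Definition betti (i j : nat) : nat :=
  \sum_(a : {ffun V -> 'I_j.+1} | \sum_v (a v : nat) == j)
     khom (fun v => a v : nat) i.
End Betti.

Definition binZ (n : nat) (z : int) : nat :=
  match z with Posz m => 'C(n, m) | Negz _ => 0 end.

(* The cycle C_k on 'I_k (for k = 2 this is K_2) *)
Definition cycle_adj (k : nat) (u v : 'I_k) : bool :=
  (u != v) && ((v == (u.+1 %% k) :> nat) || (u == (v.+1 %% k) :> nat)).

Definition G1 (k : nat) (u v : 'I_k) : bool := (u != v) && ~~ cycle_adj u v.

Definition joinG1 (d k : nat) : rel ('I_d * 'I_k)%type :=
  fun x y => if x.1 != y.1 then true else G1 x.2 y.2.
Arguments joinG1 : clear implicits.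

(* Main.v *)
Require Import Defs.
From mathcomp Require Import all_boot all_order all_algebra.
From mathcomp Require Import zify ring.
Import GRing.Theory Num.Theory.
Set Implicit Arguments. Unset Strict Implicit. Unset Printing Implicit Defensive.
Local Open Scope ring_scope.

(* If some exponent of the multidegree [a] is at least 2, the Koszul complex in
   degree [a] is exact; in the squarefree degree [W] it is the augmented cochain
   complex of the independence complex of [H] restricted to [W], and that complex
   is a disjoint union of [d] restricted clique complexes of the cycle.  Its
   coboundary from vertices to edges has rank (number of cycle edges inside [W])
   minus (number of copies of the cycle contained in [W]), and it has triangles
   only if [k = 3].  Summing over [W] amounts to counting the [W] that contain a
   given vertex, edge or copy.  Since the two arcs of the cycle coincide for
   [k = 2], edges are counted as arcs [x -> nxt x]: the rank is then
   #arcs - #full copies for every [k >= 2]. *)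

(** * Rank bounds for matrices indexed by a finite type *)

Section Rank.
Variables (K : fieldType) (T : finType).
Implicit Types (f g : T -> T -> K) (B : {set T}) (c : T -> K).

(** [kdiff] unfolds to [fmx] of [kdiff_entry], so rank bounds on [fmx] apply to the Koszul
    differential directly. *)
Definition fmx f : 'M[K]_(#|T|) := \matrix_(r, s) f (enum_val r) (enum_val s).

Lemma sum_enum_val (g : T -> K) : \sum_x g x = \sum_(j < #|T|) g (enum_val j).
Proof.
rewrite (reindex (@enum_val T predT)) //=.
by apply: onW_bij; exists enum_rank; [apply: enum_valK | apply: enum_rankK].
Qed.

Definition setmx B : 'M[K]_(#|T|) := fmx (fun x y => ((x == y) && (x \in B))%:R).

(** The coordinate projection factors as [C *m C^T], where [C] is the inclusion of the coordinates
    in [B] and [C^T *m C = 1]. *)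
Lemma rank_setmx B : \rank (setmx B) = #|B|.
Proof.
pose C : 'M[K]_(#|T|, #|B|) := \matrix_(r, s) (enum_val r == enum_val s)%:R.
have CtC : C^T *m C = 1%:M.
  apply/matrixP=> r s; rewrite !mxE (bigD1 (enum_rank (enum_val r))) //= !mxE.
  rewrite enum_rankK eqxx mul1r (inj_eq enum_val_inj) big1 ?addr0 // => j.
  by rewrite !mxE -(inj_eq enum_val_inj) enum_rankK => /negPf ->; rewrite mul0r.
have CCt : setmx B = C *m C^T.
  apply/matrixP=> r s; rewrite !mxE; have [rB|rB] := boolP (enum_val r \in B).
    rewrite (bigD1 (enum_rank_in rB (enum_val r))) //= !mxE enum_rankK_in // eqxx.
    rewrite mul1r andbT eq_sym big1 ?addr0 // => j.
    rewrite !mxE -(inj_eq enum_val_inj) enum_rankK_in // eq_sym => /negPf ->.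
    by rewrite mul0r.
  rewrite andbF big1 // => j _; rewrite !mxE.
  case: eqP => [rj|]; last by rewrite mul0r.
  by rewrite rj enum_valP in rB.
apply/eqP; rewrite eqn_leq; apply/andP; split.
  by rewrite CCt (leq_trans (mxrankM_maxl _ _)) // rank_leq_col.
have <- : \rank (C^T *m setmx B *m C) = #|B| by rewrite CCt mulmxA CtC mul1mx CtC mxrank1.
by rewrite (leq_trans (mxrankM_maxl _ _)) // mxrankM_maxr.
Qed.

Lemma fmx_setmx f B : fmx f *m setmx B = fmx (fun x y => if y \in B then f x y else 0).
Proof.
apply/matrixP=> r s; rewrite !mxE (bigD1 s) //= !mxE eqxx /= big1 ?addr0.
  by case: ifP => _; rewrite ?mulr1 ?mulr0.
by move=> u us; rewrite !mxE (inj_eq enum_val_inj) (negPf us) mulr0.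
Qed.

(** The hypothesis is linear independence of the columns in [B]. Each column of [cokermx M],
    restricted to [B], is a vector supported on [B] and killed by [f], hence zero; the rank of
    [cokermx M] then gives the bound. *)
Lemma rank_fmx_ge f B :
  (forall c, (forall y, y \notin B -> c y = 0) ->
     (forall x, \sum_y f x y * c y = 0) -> forall y, c y = 0) ->
  (#|B| <= \rank (fmx f))%N.
Proof.
move=> inj; set M := fmx f *m setmx B.
suff h0 : setmx B *m cokermx M = 0.
  have := mulmx0_rank_max h0; rewrite rank_setmx mxrank_coker.
  have h1 := rank_leq_row M; have : (\rank M <= \rank (fmx f))%N by apply: mxrankM_maxl.
  lia.
apply/matrixP=> r s; rewrite [RHS]mxE.
have := inj (fun x => (setmx B *m cokermx M) (enum_rank x) s) _ _ (enum_val r).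
rewrite enum_valK; apply.
  move=> y yB; rewrite mxE big1 // => j _; rewrite !mxE enum_rankK (negPf yB).
  by rewrite andbF mul0r.
move=> x; have := mulmx_coker M; rewrite -mulmxA => /matrixP/(_ (enum_rank x) s).
rewrite [RHS]mxE [LHS]mxE => {2}<-.
rewrite sum_enum_val; apply: eq_bigr => j _.
by rewrite enum_valK [fmx f _ _]mxE enum_rankK.
Qed.

(** The hypothesis says, dually, that the columns in [B] span all columns: a row vector orthogonal
    to the former is orthogonal to the latter. *)
Lemma rank_fmx_le f B :
  (forall c, (forall y, y \in B -> \sum_x c x * f x y = 0) ->
     forall y, \sum_x c x * f x y = 0) ->
  (\rank (fmx f) <= #|B|)%N.
Proof.
move=> inj; set M := fmx f *m setmx B.
suff h0 : kermx M *m fmx f = 0.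
  have := mulmx0_rank_max h0; rewrite mxrank_ker.
  have h1 := rank_leq_row M; have : (\rank M <= #|B|)%N.
    by rewrite -rank_setmx; apply: mxrankM_maxr.
  lia.
apply/matrixP=> r s; rewrite [RHS]mxE mxE.
have := inj (fun x => kermx M r (enum_rank x)) _ (enum_val s).
rewrite sum_enum_val => h; rewrite -[RHS]h.
  by apply: eq_bigr => j _; rewrite enum_valK [fmx f _ _]mxE.
move=> y yB; have := mulmx_ker M => /matrixP/(_ r (enum_rank y)).
rewrite [RHS]mxE [LHS]mxE => {2}<-; rewrite sum_enum_val; apply: eq_bigr => j _.
by rewrite enum_valK /M fmx_setmx [fmx _ _ _]mxE enum_rankK yB.
Qed.
End Rank.

(** * The Koszul complex: reduction to squarefree multidegrees *)

Section Koszul.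
Variables (K : fieldType) (V : finType) (E : rel V).
Implicit Types (a b : V -> nat) (F W : {set V}).

Lemma eq_khom a b i : a =1 b -> khom K E a i = khom K E b i.
Proof.
move=> ab; have kb j : kbasis E a j = kbasis E b j.
  apply/setP=> F; rewrite !inE; congr [&& _, _ & _].
    by apply: eq_forallb => v; rewrite ab.
  by apply: eq_forallb => u; apply: eq_forallb => v; rewrite !ab.
have kd j : kdiff K E a j = kdiff K E b j.
  by apply/matrixP=> r s; rewrite !mxE /kdiff_entry !kb.
by rewrite /khom !kb !kd.
Qed.

Lemma kdiff_entryD1 a i F v :
  v \in F -> F \in kbasis E a i.+1 -> F :\ v \in kbasis E a i ->
  kdiff_entry K E a i.+1 F (F :\ v) = (-1) ^+ kpos F v.
Proof.
move=> vF Fb Fvb; rewrite /kdiff_entry Fb Fvb subD1set /=.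
by rewrite setDDr setDv set0U (setIidPr _) ?sub1set // big_set1.
Qed.

Lemma kdiff_entry_neq0 a i F F' : kdiff_entry K E a i.+1 F F' != 0 ->
  [/\ F \in kbasis E a i.+1, F' \in kbasis E a i & exists2 v, v \in F & F' = F :\ v].
Proof.
rewrite /kdiff_entry; case: and3P => [[Fb F'b sF] _|]; last by rewrite eqxx.
split=> //; have cF : #|F :\: F'| == 1.
  rewrite cardsD (setIidPr sF).
  by move: Fb F'b; rewrite !inE => /andP[/eqP -> _] /andP[/eqP -> _]; apply/eqP; lia.
have /cards1P[v vE] := cF; exists v.
  by have := set11 v; rewrite -vE inE => /andP[].
by rewrite -vE setDDr setDv set0U (setIidPr sF).
Qed.

Lemma kdiff_entryD1_eq0 a i F v :
  v \in F -> F \in kbasis E a i.+1 -> F :\ v \in kbasis E a i ->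
  (kdiff_entry K E a i.+1 F (F :\ v) == 0) = false.
Proof. by move=> vF Fb Fvb; rewrite kdiff_entryD1 // signr_eq0. Qed.

(** The propagation step of the lower rank bounds: in the relation given by row [F], only the term
    of [F :\ v] survives, and its coefficient is a sign. *)
Lemma kdiff_row_eq0 a i F v (c : {set V} -> K) :
  v \in F -> F \in kbasis E a i.+1 -> F :\ v \in kbasis E a i ->
  (forall u, u \in F -> F :\ u \in kbasis E a i -> u != v -> c (F :\ u) = 0) ->
  \sum_F' kdiff_entry K E a i.+1 F F' * c F' = 0 -> c (F :\ v) = 0.
Proof.
move=> vF Fb Fvb c0; rewrite (bigD1 (F :\ v)) //= big1 ?addr0 => [|F' F'v].
  by move/eqP; rewrite mulf_eq0 kdiff_entryD1_eq0 //= => /eqP.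
have [->|/kdiff_entry_neq0[_ F'b [u uF F'E]]] := eqVneq (kdiff_entry K E a i.+1 F F') 0.
  by rewrite mul0r.
rewrite F'E c0 ?mulr0 //; first by rewrite -F'E.
by apply: contraNneq F'v => uv; rewrite F'E uv.
Qed.

(** If [a v] is at least 2, the exponent of [v] stays positive whether or not [v] lies in [F], so
    the monomial keeps its support. *)
Lemma kbasis_setU1 a i F v :
  (1 < a v)%N -> v \notin F -> (v |: F \in kbasis E a i.+1) = (F \in kbasis E a i).
Proof.
move=> av vF; rewrite !inE cardsU1 vF add1n eqSS; congr [&& _, _ & _].
  apply/forall_inP/forall_inP => h u uF; first by rewrite h // !inE uF orbT.
  by move: uF; rewrite !inE => /predU1P[->|/h //]; lia.
have aE u : (0 < a u - (u \in v |: F))%N = (0 < a u - (u \in F))%N.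
  rewrite !inE; case: (eqVneq u v) => [->|] //=; rewrite (negPf vF); lia.
by apply: eq_forallb => u; apply: eq_forallb => w; rewrite !aE.
Qed.

(** Pair the column [F] with the row [v |: F]. The other facets of [v |: F] still contain [v], so
    they are not among the chosen columns and the submatrix is diagonal with sign entries. *)
Lemma rank_kdiff_ge_toggle a i v : (1 < a v)%N ->
  (#|[set F in kbasis E a i | v \notin F]| <= \rank (kdiff K E a i.+1))%N.
Proof.
move=> av; apply: rank_fmx_ge => c c0 h F.
have [|/c0 //] := boolP (F \in [set F in kbasis E a i | v \notin F]).
rewrite inE => /andP[Fb vF].
have FE : (v |: F) :\ v = F by rewrite setU1K.
rewrite -FE; apply: (kdiff_row_eq0 _ _ _ _ (h _)); rewrite ?setU11 ?FE ?kbasis_setU1 //.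
move=> u _ _ uv; apply: c0; rewrite !inE eqxx /= negb_and negbK orbC.
by rewrite eq_sym uv.
Qed.

(** Toggling [v] is a perfect matching of the complex: the basis elements containing [v] are bounded
    by the rank of the outgoing differential, those avoiding [v] by the rank of the incoming one. *)
Lemma khom_eq0 a i v : (1 < a v)%N -> khom K E a i.+1 = 0%N.
Proof.
move=> av; have h1 := rank_kdiff_ge_toggle i av; have h2 := rank_kdiff_ge_toggle i.+1 av.
have h3 : (#|[set F in kbasis E a i.+1 | v \in F]| <= #|[set F in kbasis E a i | v \notin F]|)%N.
  rewrite -(card_in_imset (f := fun F => F :\ v)) => [|F G].
    apply/subset_leq_card/subsetP => _ /imsetP[F /setIdP[Fb vF] ->].
    by rewrite inE setD11 andbT -(kbasis_setU1 _ av) ?setD11 ?setD1K.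
  by rewrite !inE => /andP[_ vF] /andP[_ vG] FG; rewrite -(setD1K vF) FG setD1K.
have := cardsID [set F : {set V} | v \in F] (kbasis E a i.+1).
have -> : kbasis E a i.+1 :&: [set F : {set V} | v \in F] = [set F in kbasis E a i.+1 | v \in F].
  by apply/setP=> F; rewrite !inE.
have -> : kbasis E a i.+1 :\: [set F : {set V} | v \in F] = [set F in kbasis E a i.+1 | v \notin F].
  by apply/setP=> F; rewrite !inE andbC.
rewrite /khom => <-; apply/eqP; rewrite -subnDA subn_eq0 leq_add //.
exact: leq_trans h3 h1.
Qed.

Definition mdeg W : V -> nat := fun v => v \in W.

(** The passage to Hochster's formula: [W :\: F] is a face of the independence complex restricted to
    [W], so Koszul degree [i] corresponds to faces with [#|W| - i] vertices. *)
Lemma kbasis_mdeg W i F : (F \in kbasis E (mdeg W) i) =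
  [&& #|F| == i, F \subset W & [forall u in W :\: F, forall v in W :\: F, ~~ E u v]].
Proof.
rewrite inE; congr [&& _, _ & _].
  by rewrite /mdeg; apply/forall_inP/subsetP => h v /h; case: (v \in W).
have aE v : (0 < mdeg W v - (v \in F))%N = (v \in W :\: F).
  by rewrite /mdeg inE; case: (v \in W); case: (v \in F).
apply/'forall_forallP/'forall_implyP => h u.
  move=> uWF; apply/forall_inP => v vWF; have := h u v.
  by rewrite !aE uWF vWF; case: (E u v).
move=> v; rewrite !aE; apply/implyP => Euv; apply/negP => /andP[/h/forall_inP h1 /h1].
by rewrite Euv.
Qed.

Lemma betti_sum_sqfree i j :
  betti K E i.+1 j.+1 = (\sum_(W : {set V} | #|W| == j.+1) khom K E (mdeg W) i.+1)%N.
Proof.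
pose sq := [pred a : {ffun V -> 'I_j.+2} | [forall v, (a v <= 1)%N]].
rewrite /betti (bigID sq) /= [X in (_ + X)%N]big1 ?addn0; last first.
  move=> a /andP[_]; rewrite negb_forall => /existsP[v]; rewrite -ltnNge => av.
  exact: (khom_eq0 _ av).
(* The multidegrees with all exponents at most 1 are indicator functions; exponents range over
   ['I_j.+2], which always contains 0 and 1. *)
pose ind W : {ffun V -> 'I_j.+2} := [ffun v => inord (v \in W)].
have indE W v : ind W v = (v \in W) :> nat by rewrite ffunE inordK //; case: (v \in W).
rewrite (reindex ind) /=; last first.
  exists (fun a : {ffun V -> 'I_j.+2} => [set v | a v == 1%N :> nat]) => [W _|a].
    by apply/setP=> v; rewrite inE indE; case: (v \in W).
  rewrite inE => /andP[_ /forallP a1]; apply/ffunP=> v; apply/val_inj.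
  by rewrite /= indE inE; case: (a v : nat) (a1 v) => [|[|]].
apply: eq_big => [W|W _]; last by apply: eq_khom => v; rewrite indE.
have -> : (\sum_v ind W v = #|W|)%N.
  by rewrite -sum1_card [RHS]big_mkcond /=; apply: eq_bigr => v _; rewrite indE; case: (v \in W).
by rewrite (_ : [forall v, _] = true) ?andbT //; apply/forallP => v; rewrite indE; case: (v \in W).
Qed.
End Koszul.

(** * The empty face and the vertices, in a squarefree multidegree *)

Section KoszulTop.
Variables (K : fieldType) (V : finType) (E : rel V) (W : {set V}) (m : nat).
Hypotheses (Eirr : irreflexive E) (cW : #|W| = m.+1).

Lemma kbasis_top F : (F \in kbasis E (mdeg W) m.+1) = (F == W).
Proof.
rewrite kbasis_mdeg; apply/idP/eqP => [/and3P[/eqP cF sF _]|->].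
  by apply/eqP; rewrite eqEcard sF cF cW leqnn.
by rewrite cW eqxx subxx setDv; apply/forall_inP => u; rewrite inE.
Qed.

Lemma kbasis_facet : kbasis E (mdeg W) m = [set W :\ v | v in W].
Proof.
apply/setP=> F; rewrite kbasis_mdeg; apply/and3P/imsetP => [[/eqP cF sF _]|[v vW ->]].
  have /eqP/cards1P[v vE] : #|W :\: F| = 1%N by rewrite cardsD (setIidPr sF) cF cW; lia.
  exists v; first by have := set11 v; rewrite -vE inE => /andP[].
  by rewrite -vE setDDr setDv set0U (setIidPr sF).
split; rewrite ?subD1set //; first by have := cardsD1 v W; rewrite vW cW => -[->].
rewrite setDDr setDv set0U (setIidPr _) ?sub1set //.
apply/forall_inP => u /set1P ->; apply/forall_inP => w /set1P ->.
by rewrite Eirr.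
Qed.

Lemma setD1_inj_in : {in W &, injective (fun v => W :\ v)}.
Proof.
move=> u v uW vW /setP/(_ u); rewrite !inE eqxx uW /= andbT => /esym/negbFE/eqP.
by [].
Qed.

Lemma card_kbasis_facet : #|kbasis E (mdeg W) m| = m.+1.
Proof. by rewrite kbasis_facet card_in_imset ?cW //; exact: setD1_inj_in. Qed.

(** This is the augmentation: its only nonzero row is that of [W], the empty face, and that row has
    a nonzero entry because [W] is nonempty. *)
Lemma rank_kdiff_top : \rank (kdiff K E (mdeg W) m.+1) = 1%N.
Proof.
have /card_gt0P[v vW] : (0 < #|W|)%N by rewrite cW.
have Wb : W \in kbasis E (mdeg W) m.+1 by rewrite kbasis_top.
have Wvb : W :\ v \in kbasis E (mdeg W) m by rewrite kbasis_facet; apply/imsetP; exists v.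
apply/eqP; rewrite eqn_leq -(cards1 (W :\ v)); apply/andP; split.
  apply: rank_fmx_le => c /(_ _ (set11 _)) h F'.
  have cW0 : c W = 0.
    move: h; rewrite (bigD1 W) //= big1 ?addr0 => [|F FW].
      by move/eqP; rewrite mulf_eq0 kdiff_entryD1_eq0 // orbF => /eqP.
    have [->|/kdiff_entry_neq0[]] := eqVneq (kdiff_entry K E (mdeg W) m.+1 F (W :\ v)) 0.
      by rewrite mulr0.
    by rewrite kbasis_top (negPf FW).
  rewrite big1 // => F _.
  have [->|/kdiff_entry_neq0[]] := eqVneq (kdiff_entry K E (mdeg W) m.+1 F F') 0.
    by rewrite mulr0.
  by rewrite kbasis_top => /eqP ->; rewrite cW0 mul0r.
apply: rank_fmx_ge => c c0 h F'; have [->|F'v] := eqVneq F' (W :\ v); last first.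
  by apply: c0; rewrite inE.
apply: (kdiff_row_eq0 vW Wb Wvb _ (h _)) => u uW _ uv; apply: c0.
by rewrite inE; apply: contraNneq uv => /setD1_inj_in ->.
Qed.
End KoszulTop.

Lemma kpos_setD1 (V : finType) (W : {set V}) (x y : V) : x \in W -> x != y ->
  kpos W y = (kpos (W :\ x) y + (enum_rank x < enum_rank y))%N.
Proof.
move=> xW xy; rewrite /kpos (cardsD1 x) inE xW /= addnC; congr (_ + _)%N.
by apply: eq_card => u; rewrite !inE andbA.
Qed.

(* The Koszul relation d^2 = 0, read on the coefficient of [W :\ x :\ y]. *)
Lemma kpos_anticomm (K : fieldType) (V : finType) (W : {set V}) (x y : V) :
  x \in W -> y \in W -> x != y ->
  (-1) ^+ kpos W x * (-1) ^+ kpos (W :\ x) y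
    = - ((-1) ^+ kpos W y * (-1) ^+ kpos (W :\ y) x) :> K.
Proof.
move=> xW yW xy; rewrite (kpos_setD1 xW xy) (@kpos_setD1 _ W y x) 1?eq_sym //.
rewrite -!exprD -[RHS]mulN1r -exprS -signr_odd -[RHS]signr_odd; congr (_ ^+ nat_of_bool _).
have : (enum_rank x < enum_rank y)%N = ~~ (enum_rank y < enum_rank x)%N.
  by rewrite -leqNgt ltn_neqAle (inj_eq val_inj) (inj_eq enum_rank_inj) xy.
lia.
Qed.

(** * Arcs and edges of the disjoint cycles *)

Section CycleJoin.
Variables (K : fieldType) (d k : nat).
Hypothesis k_gt1 : (1 < k)%N.
Local Notation V := ('I_d * 'I_k)%type.
Local Notation E := (joinG1 d k).
Implicit Types (x y : V) (W : {set V}) (j : 'I_d).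

Definition nxt x : V := (x.1, ordS x.2).
Definition edge x : {set V} := [set x; nxt x].
Definition arcs W : {set V} := [set x in W | nxt x \in W].
Definition copy j : {set V} := [set x | x.1 == j].
Definition full W : {set 'I_d} := [set j | copy j \subset W].
(* Dropping one arc of each full copy leaves a forest, even if [k = 2]. *)
Definition basis_arcs W : {set V} :=
  [set x in arcs W | ~~ ((x.2 == 0%N :> nat) && (x.1 \in full W))].

Lemma nxt2E x : (nxt x).2 = (if x.2.+1 == k then 0 else x.2.+1)%N :> nat.
Proof.
rewrite /=; case: eqP => [->|uk]; first by rewrite modnn.
by rewrite modn_small //; have := ltn_ord x.2; lia.
Qed.

Lemma nxt_inj : injective nxt.
Proof.
move=> [a u] [b v] uv; have /= -> := congr1 fst uv.
by have /= /(can_inj (@ordSK k)) -> := congr1 snd uv.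
Qed.

Lemma nxt_neq x : nxt x != x.
Proof.
apply/eqP => e; have := nxt2E x; rewrite e; have := ltn_ord x.2.
by case: eqP; lia.
Qed.

Lemma nxt_invol x : nxt (nxt x) = x -> k = 2%N.
Proof.
move=> e; have := nxt2E (nxt x); rewrite e nxt2E; have := ltn_ord x.2.
by case: eqP; case: eqP; lia.
Qed.

Lemma nxt_cover x y : k = 2%N -> y.1 = x.1 -> y = x \/ y = nxt x.
Proof.
case: x y => [a u] [b v] /= k2 ->.
have : (v == u :> nat) || (v == (nxt (a, u)).2 :> nat).
  rewrite nxt2E /=; move: (ltn_ord u) (ltn_ord v); case: ifP; lia.
by case/orP => /eqP/val_inj ->; [left | right].
Qed.

Lemma nxt_zero x : k = 2%N -> (x.2 == 0%N :> nat) || ((nxt x).2 == 0%N :> nat).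
Proof.
by rewrite nxt2E; case: x => [a u] /= k2; move: (ltn_ord u); case: ifP; lia.
Qed.

(** Induction around one copy of the cycle, from an arbitrary starting point. *)
Lemma nxt_ind (P : V -> Prop) x :
  P x -> (forall y, y.1 = x.1 -> P y -> P (nxt y)) -> forall y, y.1 = x.1 -> P y.
Proof.
move=> Px Pn; have kp : (0 < k)%N by lia.
have IH n : forall y, y.1 = x.1 -> y.2 = ((x.2 + n) %% k)%N :> nat -> P y.
  elim: n => [|n IHn] y y1 y2.
    rewrite addn0 modn_small // in y2.
    by rewrite (_ : y = x) //; case: (y) (x) y1 y2 => [a u] [b v] /= -> /val_inj ->.
  pose z : V := (x.1, Ordinal (ltn_pmod (x.2 + n)%N kp)).
  rewrite (_ : y = nxt z); first by apply: Pn => //; apply: IHn.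
  rewrite [y]surjective_pairing y1; congr (_, _); apply/val_inj.
  by rewrite /= y2 -[(_ %% _).+1]addn1 modnDml addn1 addnS.
(* A full extra turn keeps the number of steps from [x] to [y] a natural number even when
   [y.2 < x.2]. *)
move=> y y1; apply: (IH (y.2 + (k - x.2))%N) => //.
have := ltn_ord x.2 => xk; rewrite (_ : (_ + _ = y.2 + k)%N); last by lia.
by rewrite modnDr modn_small.
Qed.

Lemma joinG1_irr : irreflexive E.
Proof. by move=> x; rewrite /joinG1 /G1 !eqxx. Qed.

Lemma joinG1_sym : symmetric E.
Proof.
move=> x y; rewrite /joinG1 (eq_sym y.1); case: ifP => // _.
rewrite /G1 /cycle_adj (eq_sym y.2); congr (_ && ~~ (_ && _)); exact: orbC.
Qed.

Lemma joinG1_nonadj x y : x != y -> ~~ E x y = (y == nxt x) || (x == nxt y).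
Proof.
case: x y => [a u] [b v]; rewrite /joinG1 /G1 /cycle_adj /nxt !xpair_eqE /=.
have [_|_] /= := eqVneq a b; last by [].
by move=> ->; rewrite negbK.
Qed.

Lemma arcsP W x : reflect (x \in W /\ nxt x \in W) (x \in arcs W).
Proof. by rewrite inE; apply: andP. Qed.

Lemma setD1_edge W x : W :\ x :\ nxt x = W :\: edge x.
Proof. by rewrite setDDl. Qed.

Lemma setD1_edge_swap W x : W :\ nxt x :\ x = W :\: edge x.
Proof. by rewrite setDDl setUC. Qed.

(** The faces here have two vertices; non-adjacent vertices of the join are consecutive on one copy
    of the cycle. For [k = 2] opposite arcs give the same face. *)
Lemma kbasis_edge W m : #|W| = m.+2 ->
  kbasis E (mdeg W) m = [set W :\: edge x | x in arcs W].
Proof.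
move=> cW; apply/setP=> F; rewrite kbasis_mdeg.
apply/and3P/imsetP => [[/eqP cF sF /forall_inP ind]|[x /arcsP[xW nW] ->]]; last first.
  have sE : edge x \subset W by apply/subsetP => y /set2P[] ->.
  rewrite cardsD (setIidPr sE) cards2 (eq_sym x) nxt_neq cW subsetDl subn2 eqxx; split=> //.
  rewrite setDDr setDv set0U (setIidPr sE).
  have nE : ~~ E x (nxt x) by rewrite joinG1_nonadj 1?eq_sym ?nxt_neq ?eqxx.
  apply/forall_inP => u /set2P[]->; apply/forall_inP => w /set2P[]->;
    by rewrite ?joinG1_irr // joinG1_sym.
have /eqP/cards2P[x [y [xy WF]]] : #|W :\: F| = 2%N by rewrite cardsD (setIidPr sF) cF cW; lia.
have FE : F = W :\: [set x; y] by rewrite -WF setDDr setDv set0U (setIidPr sF).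
have xWF : x \in W :\: F by rewrite WF set21.
have yWF : y \in W :\: F by rewrite WF set22.
have := forall_inP (ind x xWF) y yWF; rewrite joinG1_nonadj //.
have xW : x \in W by case/setDP: xWF.
have yW : y \in W by case/setDP: yWF.
case/orP => /eqP E1; [exists x | exists y]; rewrite ?FE ?E1 //.
- by rewrite inE xW -E1.
- by rewrite inE yW -E1.
- by rewrite setUC.
Qed.

Lemma setD_edge_inj W x y : x \in arcs W -> y \in arcs W ->
  W :\: edge x = W :\: edge y -> x = y \/ x = nxt y /\ y = nxt x.
Proof.
move=> /arcsP[xW _] /arcsP[yW _] exy.
have : x \in edge y.
  by move/setP/(_ x): exy; rewrite !inE xW eqxx /= andbT; case: (_ || _).
have : y \in edge x.
  by move/setP/(_ y): exy; rewrite !inE yW eqxx /= andbT; case: (_ || _).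
by move=> /set2P[->|->] /set2P[]; auto.
Qed.

Lemma fullP W j : reflect (forall x, x.1 = j -> x \in W) (j \in full W).
Proof.
rewrite inE; apply: (iffP subsetP) => h x; first by move=> xj; apply: h; rewrite inE xj.
by rewrite inE => /eqP /h.
Qed.

(** Two arcs share an edge only if they are opposite, which forces [k = 2]. The copy is then full
    and one of the two arcs starts at position 0, so it has been dropped. *)
Lemma basis_arcs_inj W : {in basis_arcs W &, injective (fun x => W :\: edge x)}.
Proof.
move=> x y /setIdP[xA xb] /setIdP[yA yb] /(setD_edge_inj xA yA)[//|[xE yE]].
have k2 : k = 2%N by apply: (@nxt_invol x); rewrite -yE.
have xF : x.1 \in full W.
  apply/fullP => z z1; move/arcsP: xA => [xW nW].
  by have [->|->] := nxt_cover k2 z1.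
move: xb yb; rewrite yE (_ : (nxt x).1 = x.1) // xF !andbT.
by case/orP: (nxt_zero x k2) => ->.
Qed.

Lemma card_basis_edges W :
  #|[set W :\: edge x | x in basis_arcs W]| = #|basis_arcs W|.
Proof. by rewrite card_in_imset //; exact: basis_arcs_inj. Qed.

Lemma edge_entry W m x : #|W| = m.+2 -> x \in arcs W ->
  kdiff_entry K E (mdeg W) m.+1 (W :\ x) (W :\: edge x) = (-1) ^+ kpos (W :\ x) (nxt x) /\
  kdiff_entry K E (mdeg W) m.+1 (W :\ nxt x) (W :\: edge x) = (-1) ^+ kpos (W :\ nxt x) x.
Proof.
move=> cW xA; have /arcsP[xW nW] := xA.
have eb : W :\: edge x \in kbasis E (mdeg W) m by rewrite kbasis_edge //; apply/imsetP; exists x.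
have fb y : y \in W -> W :\ y \in kbasis E (mdeg W) m.+1.
  by move=> yW; rewrite (kbasis_facet joinG1_irr cW); apply/imsetP; exists y.
split; first by rewrite -setD1_edge kdiff_entryD1 ?setD1_edge ?fb // !inE nW nxt_neq.
by rewrite -setD1_edge_swap kdiff_entryD1 ?setD1_edge_swap ?fb // !inE xW eq_sym nxt_neq.
Qed.

(* Up to the signs [(-1) ^+ kpos W x], the differential is the coboundary of the
   graph of arcs: a cocycle takes the same value at both ends of an arc. *)
Lemma kdiff_col_eq0 W m x (c : {set V} -> K) : #|W| = m.+2 -> x \in arcs W ->
  \sum_F c F * kdiff_entry K E (mdeg W) m.+1 F (W :\: edge x) = 0 <->
  (-1) ^+ kpos W x * c (W :\ x) = (-1) ^+ kpos W (nxt x) * c (W :\ nxt x).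
Proof.
move=> cW xA; have /arcsP[xW nW] := xA; have [e1 e2] := edge_entry cW xA.
have Wne : W :\ nxt x != W :\ x.
  by apply: contraNneq (nxt_neq x) => /setD1_inj_in ->.
rewrite (bigD1 (W :\ x)) //= (bigD1 (W :\ nxt x)) //= big1 ?addr0 ?e1 ?e2; last first.
  move=> F /andP[Fx Fn]; have [->|] := eqVneq (kdiff_entry K E (mdeg W) m.+1 F (W :\: edge x)) 0.
    by rewrite mulr0.
  case/kdiff_entry_neq0; rewrite (kbasis_facet joinG1_irr cW) => /imsetP[u uW FE] _ [w _ eE].
  have : u \notin W :\: edge x by rewrite eE FE !inE eqxx andbF.
  by rewrite !inE uW andbT negbK => /orP[]/eqP uE; move: Fx Fn; rewrite FE uE eqxx.
have := kpos_anticomm K xW nW; rewrite eq_sym nxt_neq => /(_ isT).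
set p := (-1) ^+ kpos W x; set q := (-1) ^+ kpos W (nxt x).
set a := (-1) ^+ _; set b := (-1) ^+ _ => pa.
have pp : p * p = 1 by rewrite -expr2 sqrr_sign.
have qq : q * q = 1 by rewrite -expr2 sqrr_sign.
have -> : a = - (p * q * b) by rewrite -[a]mul1r -pp -mulrA pa mulrN mulrA.
(* The factorisation holds only modulo [q * q = 1]; the explicit multiple of [1 - q * q] makes it a
   ring identity. *)
have -> : c (W :\ x) * - (p * q * b) + c (W :\ nxt x) * b
  = q * b * (q * c (W :\ nxt x) - p * c (W :\ x)) + (1 - q * q) * (c (W :\ nxt x) * b).
  by ring.
rewrite qq subrr mul0r addr0.
split=> [/eqP|->]; last by rewrite subrr mulr0.
by rewrite !mulf_eq0 !signr_eq0 /= subr_eq0 => /eqP.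
Qed.

(** * The rank of the coboundary from vertices to edges *)

Lemma edge_kbasis W m x : #|W| = m.+2 -> x \in arcs W ->
  W :\: edge x \in kbasis E (mdeg W) m.
Proof. by move=> cW xA; rewrite kbasis_edge //; apply/imsetP; exists x. Qed.

(** A forest carries no nonzero cycle: the row of [W :\ v] is the balance of [c] over the edges at
    [v], so the vanishing of [c] passes from each arc to the next one around the copy. *)
Lemma rank_kdiff_edge_ge W m : #|W| = m.+2 ->
  (#|basis_arcs W| <= \rank (kdiff K E (mdeg W) m.+1))%N.
Proof.
move=> cW; rewrite -card_basis_edges; apply: rank_fmx_ge => c c0 h.
pose Z x := x \in arcs W -> c (W :\: edge x) = 0.
(* The only edges at [nxt x] are those of the arcs [x] and [nxt x]. In the second alternative they
   coincide, so the balance at [nxt x] has a single term. *)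
have step x : Z x \/ nxt (nxt x) = x -> Z (nxt x).
  move=> Zx /arcsP[vW nvW]; rewrite -setD1_edge.
  have vF : nxt (nxt x) \in W :\ nxt x by rewrite !inE nvW nxt_neq.
  have Fb : W :\ nxt x \in kbasis E (mdeg W) m.+1.
    by rewrite (kbasis_facet joinG1_irr cW); apply/imsetP; exists (nxt x).
  apply: (kdiff_row_eq0 vF Fb _ _ (h _)).
    by rewrite setD1_edge edge_kbasis //; apply/arcsP.
  move=> u /setD1P[uv uW]; rewrite kbasis_mdeg => /and3P[_ _ /forall_inP ind] un.
  have uD : u \in W :\: (W :\ nxt x :\ u) by rewrite !inE uW eqxx.
  have vD : nxt x \in W :\: (W :\ nxt x :\ u) by rewrite !inE vW eqxx andbF.
  have := forall_inP (ind u uD) _ vD; rewrite joinG1_nonadj // (negPf un) orbF.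
  move=> /eqP/nxt_inj xu; rewrite -xu setD1_edge_swap.
  case: Zx => [|nx]; last by rewrite nx xu eqxx in un.
  by apply; apply/arcsP; rewrite vW xu uW.
have Zall x : Z x.
  have [k2|k2] := eqVneq k 2%N.
    have nn : nxt (nxt x) = x.
      case: (nxt_cover k2 (erefl : (nxt (nxt x)).1 = x.1)) => // /nxt_inj e.
      by have := nxt_neq x; rewrite e eqxx.
    by rewrite -nn; apply: step; right; rewrite !nn.
  (* Propagation starts at the dropped arc if the copy is full, and otherwise at a vertex outside
     [W], where [Z] is vacuous. *)
  have [z z1 Zz] : exists2 z, z.1 = x.1 & Z z.
    have [xF|/fullP nF] := boolP (x.1 \in full W).
      exists (x.1, Ordinal (ltnW k_gt1)) => // xA; apply: c0.
      apply/imsetP => -[y /setIdP[yA yb]] /(setD_edge_inj xA yA)[ye|[e1 e2]].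
        by rewrite -ye /= xF in yb.
      by move/eqP: k2; apply; apply: (@nxt_invol y); rewrite -e1.
    have [z zW|zW] := pickP [pred z : V | (z.1 == x.1) && (z \notin W)]; last first.
      case: nF => y yx; have := zW y; rewrite /= yx eqxx /=.
      by move/negbFE.
    move: zW => /andP[/eqP z1 zW]; exists z => // /arcsP[].
    by rewrite (negPf zW).
  by apply: (nxt_ind Zz) => // y _ Zy; apply: step; left.
move=> F; have [/imsetP[x /setIdP[xA _] ->]|/c0 //] :=
  boolP (F \in [set W :\: edge x | x in basis_arcs W]).
exact: Zall.
Qed.

(** A dropped arc imposes no new condition: a function on the vertices that is constant along all
    other arcs of a full copy already agrees at the two ends of the dropped one. *)
Lemma rank_kdiff_edge_le W m : #|W| = m.+2 ->
  (\rank (kdiff K E (mdeg W) m.+1) <= #|basis_arcs W|)%N.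
Proof.
move=> cW; rewrite -card_basis_edges; apply: rank_fmx_le => c h F'.
have [F'b|F'b] := boolP (F' \in kbasis E (mdeg W) m); last first.
  rewrite big1 // => F _.
  have [->|/kdiff_entry_neq0[_]] := eqVneq (kdiff_entry K E (mdeg W) m.+1 F F') 0.
    by rewrite mulr0.
  by rewrite (negPf F'b).
move: F'b; rewrite kbasis_edge // => /imsetP[x xA ->].
have [xb|] := boolP (x \in basis_arcs W); first by apply: h; apply/imsetP; exists x.
rewrite inE xA negbK => /andP[/eqP x0 /fullP xF].
apply/kdiff_col_eq0 => //.
pose phi y := (-1) ^+ kpos W y * c (W :\ y); rewrite -!/(phi _).
(* Walk from [nxt x] around to [x]. Every step uses a basis arc, except the one leaving [x], whose
   conclusion is trivial. *)
apply: (@nxt_ind (fun y => phi y = phi (nxt x)) (nxt x)) => // y y1 phiy.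
have [->//|yx] := eqVneq y x; rewrite -phiy; apply/esym.
have yA : y \in arcs W by apply/arcsP; split; apply: xF.
apply/(kdiff_col_eq0 _ cW yA)/h/imsetP; exists y => //; rewrite inE yA negb_and.
apply/orP; left; apply: contraNneq yx => y0; rewrite [y]surjective_pairing [x]surjective_pairing y1.
by apply/eqP; congr (_, _); apply/val_inj; rewrite /= x0 y0.
Qed.

Lemma rank_kdiff_edge W m : #|W| = m.+2 ->
  \rank (kdiff K E (mdeg W) m.+1) = #|basis_arcs W|.
Proof.
by move=> cW; apply/eqP; rewrite eqn_leq rank_kdiff_edge_ge // rank_kdiff_edge_le.
Qed.

Lemma card_basis_arcs W : (#|basis_arcs W| + #|full W| = #|arcs W|)%N.
Proof.
pose z (j : 'I_d) : V := (j, Ordinal (ltnW k_gt1)).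
rewrite -(card_imset (mem (full W)) (f := z)); last by move=> a b [].
rewrite -(cardsID (z @: full W) (arcs W)) addnC; congr (_ + _)%N; apply: eq_card => x.
  rewrite inE; apply/idP/idP => [/imsetP[j jF ->]|/andP[]//].
  rewrite imset_f // andbT; move/fullP: jF => jF.
  by apply/arcsP; split; apply: jF.
rewrite in_setD [LHS]inE [LHS]andbC; congr (~~ _ && _).
apply/andP/imsetP => [[/eqP x0 xF]|[j jF ->]]; last by [].
exists x.1 => //; rewrite [LHS]surjective_pairing; congr (_, _).
by apply/val_inj; rewrite /= x0.
Qed.

(** If every vertex of [W] started a basis arc, [W] would be closed under [nxt] and contain a full
    copy, whose vertex at position 0 starts none. This keeps the subtractions in [khom] from
    truncating. *)
Lemma card_basis_arcs_lt W : (0 < #|W|)%N -> (#|basis_arcs W| < #|W|)%N.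
Proof.
case/card_gt0P => x xW; apply: proper_card; rewrite properE.
have bW : basis_arcs W \subset W by apply/subsetP => y /setIdP[/arcsP[]].
rewrite bW /=; apply/negP => /subsetP sub.
have xF : x.1 \in full W.
  by apply/fullP; apply: (nxt_ind xW) => y _ /sub /setIdP[/arcsP[]].
have zW : (x.1, Ordinal (ltnW k_gt1)) \in W by apply: (fullP _ _ xF).
by have /setIdP[_] := sub _ zW; rewrite /= xF.
Qed.

(** * Homology at the vertices and at the edges *)

Lemma khom_linear W m : #|W| = m.+2 ->
  (khom K E (mdeg W) m.+1 + #|arcs W| = m.+1 + #|full W|)%N.
Proof.
move=> cW; rewrite /khom rank_kdiff_edge // (rank_kdiff_top K joinG1_irr cW).
rewrite (card_kbasis_facet joinG1_irr cW) -card_basis_arcs.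
have := @card_basis_arcs_lt W; rewrite cW => /(_ isT); lia.
Qed.

Lemma edge_inj W : k != 2%N -> {in arcs W &, injective (fun x => W :\: edge x)}.
Proof.
move=> k2 x y xA yA /(setD_edge_inj xA yA)[//|[e1 e2]].
by case/eqP: k2; apply: (@nxt_invol x); rewrite -e2.
Qed.

(** Every edge comes from a basis arc, since a dropped arc has the same edge as its opposite. Hence
    the coboundary from the vertices is onto the edges. *)
Lemma khom_second_k2 W m : k = 2%N -> #|W| = m.+3 -> khom K E (mdeg W) m.+1 = 0%N.
Proof.
move=> k2 cW; rewrite /khom (rank_kdiff_edge cW) (kbasis_edge cW) -card_basis_edges.
apply/eqP; rewrite -subnDA subn_eq0 (leq_trans (subset_leq_card _) (leq_addl _ _)) //.
apply/subsetP => _ /imsetP[x xA ->]; apply/imsetP.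
have [xb|] := boolP (x \in basis_arcs W); first by exists x.
rewrite inE xA negbK => /andP[/eqP x0 /fullP xF].
have nn : nxt (nxt x) = x.
  case: (nxt_cover k2 (erefl : (nxt (nxt x)).1 = x.1)) => // /nxt_inj e.
  by have := nxt_neq x; rewrite e eqxx.
exists (nxt x); last by rewrite /edge nn setUC.
rewrite inE; apply/andP; split; first by apply/arcsP; split; apply: xF.
rewrite nxt2E x0 (ltn_eqF k_gt1); exact: isT.
Qed.

Lemma nxt3_id x : k = 3%N -> nxt (nxt (nxt x)) = x.
Proof.
move=> k3; have e : (nxt (nxt (nxt x))).2 = x.2 :> nat.
  by rewrite !nxt2E; case: x => [a u] /=; move: (ltn_ord u); do !case: ifP; lia.
by rewrite [LHS]surjective_pairing [RHS]surjective_pairing (val_inj e).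
Qed.

Lemma nxt3_id_inv x : nxt (nxt (nxt x)) = x -> k = 3%N.
Proof.
move=> e; have := nxt2E (nxt (nxt x)); rewrite e !nxt2E.
by case: x {e} => [a u] /=; move: (ltn_ord u); do !case: ifP; lia.
Qed.

Lemma nxt_cover3 x y : k = 3%N -> y.1 = x.1 -> [\/ y = x, y = nxt x | y = nxt (nxt x)].
Proof.
case: x y => [a u] [b v] /= k3 ->.
have : [|| v == u :> nat, v == (nxt (a, u)).2 :> nat | v == (nxt (nxt (a, u))).2 :> nat].
  by rewrite !nxt2E /=; move: (ltn_ord u) (ltn_ord v); do !case: ifP; lia.
by case/or3P => /eqP/val_inj ->; [constructor 1 | constructor 2 | constructor 3].
Qed.

Lemma kbasis_triangle W m F :
  #|W| = m.+3 -> F \in kbasis E (mdeg W) m -> k = 3%N.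
Proof.
move=> cW; rewrite kbasis_mdeg => /and3P[/eqP cF sF /forall_inP ind].
have c3 : #|W :\: F| = 3%N by rewrite cardsD (setIidPr sF) cF cW; lia.
have /card_gt0P[x xD] : (0 < #|W :\: F|)%N by rewrite c3.
have /eqP/cards2P[y [z [yz yzE]]] : #|(W :\: F) :\ x| = 2%N.
  by have := cardsD1 x (W :\: F); rewrite c3 xD => -[].
have /setD1P[yx yD] : y \in (W :\: F) :\ x by rewrite yzE set21.
have /setD1P[zx zD] : z \in (W :\: F) :\ x by rewrite yzE set22.
have := forall_inP (ind x xD) _ yD; have := forall_inP (ind x xD) _ zD.
have := forall_inP (ind y yD) _ zD; rewrite !joinG1_nonadj // 1?eq_sym //.
move: yz yx zx => /eqP yz /eqP yx /eqP zx.
(* Of the eight orientations of the triangle, the six transitive ones make two vertices equal; the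
   two cyclic ones give a point fixed by three steps. *)
case/orP=> /eqP e1; case/orP=> /eqP e2; case/orP=> /eqP e3; try solve [
  exfalso; first [apply: yz | apply: yx | apply: zx]; congruence |
  exfalso; first [apply: yz | apply: yx | apply: zx]; apply: nxt_inj; congruence].
all: by apply: (@nxt3_id_inv x); congruence.
Qed.

(** Without triangles the first homology is the number of edges minus the rank, and each full cycle
    contributes one class. *)
Lemma khom_second_k4 W m : (3 < k)%N -> #|W| = m.+3 ->
  khom K E (mdeg W) m.+1 = #|full W|.
Proof.
move=> k4 cW; rewrite /khom (rank_kdiff_edge cW) (kbasis_edge cW).
rewrite (_ : kdiff _ _ _ m.+1 = 0) ?mxrank0; last first.
  apply/matrixP=> r s; rewrite !mxE; apply/eqP/negP => /negP/kdiff_entry_neq0[_ Fb _].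
  by have := kbasis_triangle cW Fb; lia.
rewrite subn0 card_in_imset ?(card_basis_arcs W).
  by rewrite -card_basis_arcs addKn.
by apply: edge_inj; lia.
Qed.

(** Each full copy is a filled triangle. Its column, paired with the row of one of its edges, gives
    a diagonal submatrix because an edge lies in only one triangle; so every cycle class is
    killed. *)
Lemma rank_kdiff_triangle W m : k = 3%N -> #|W| = m.+3 ->
  (#|full W| <= \rank (kdiff K E (mdeg W) m.+1))%N.
Proof.
move=> k3 cW; pose z (j : 'I_d) : V := (j, Ordinal (ltnW k_gt1)).
have inC j j' : (z j \in copy j') = (j == j') by rewrite inE.
rewrite -(card_in_imset (f := fun j => W :\: copy j)) => [|j j' /fullP jF /fullP jF']; last first.
  move/setP/(_ (z j)); rewrite !inE eqxx jF //= andbT => /esym/negbFE/eqP.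
  by [].
apply: rank_fmx_ge => c c0 h F.
have [/imsetP[j jF ->]|/c0 //] := boolP (F \in [set W :\: copy j | j in full W]).
have jW := fullP _ _ jF; pose v := nxt (nxt (z j)); set F0 := W :\: edge (z j).
have zA : z j \in arcs W by apply/arcsP; split; apply: jW.
have FE : F0 :\ v = W :\: copy j.
  rewrite setDDl; congr (_ :\: _); apply/setP=> x; rewrite !inE.
  apply/idP/eqP => [/orP[/orP[]|] /eqP -> //|x1].
  by case: (@nxt_cover3 (z j) x) => // ->; rewrite eqxx ?orbT.
have sC : copy j \subset W by apply/subsetP => x; rewrite inE => /eqP /jW.
have cC : #|copy j| = 3%N.
  have -> : copy j = setX [set j] [set: 'I_k] by apply/setP=> -[a u]; rewrite !inE andbT.
  by rewrite cardsX cards1 cardsT card_ord k3.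
have vW : v \in W by apply: jW.
have vz : v != z j.
  by apply/eqP => /nxt_invol; rewrite k3.
rewrite -FE; apply: (kdiff_row_eq0 _ _ _ _ (h _)).
- by rewrite !inE vW (negPf vz) (negPf (nxt_neq (nxt (z j)))).
- by rewrite (kbasis_edge cW); apply/imsetP; exists (z j).
- rewrite FE kbasis_mdeg cardsD (setIidPr sC) cC cW subnS subn2 eqxx subsetDl /=.
  rewrite setDDr setDv set0U (setIidPr sC).
  apply/forall_inP => x; rewrite inE => /eqP x1; apply/forall_inP => y; rewrite inE => /eqP y1.
  have [->|xy] := eqVneq x y; first by rewrite joinG1_irr.
  rewrite joinG1_nonadj //; have yx1 : y.1 = x.1 by rewrite x1 y1.
  case: (nxt_cover3 k3 yx1) xy => [->|->|->]; rewrite ?eqxx //.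
  by rewrite nxt3_id ?eqxx ?orbT.
- move=> u uF _ uv; apply: c0; apply/imsetP => -[j' _ /setP e].
  have := e (z j); rewrite !inE eqxx /= andbF jW //= andbT => /esym/negbFE/eqP jj'.
  by have := e v; rewrite !inE vW (eq_sym v) uv (negPf vz) (negPf (nxt_neq (nxt (z j)))) -jj' eqxx.
Qed.

Lemma khom_second_k3 W m : k = 3%N -> #|W| = m.+3 -> khom K E (mdeg W) m.+1 = 0%N.
Proof.
move=> k3 cW; rewrite /khom (rank_kdiff_edge cW) (kbasis_edge cW).
rewrite card_in_imset; last by apply: edge_inj; rewrite k3.
by rewrite -card_basis_arcs; have := rank_kdiff_triangle k3 cW; lia.
Qed.
End CycleJoin.

(** * Counting the sets that contain a given set *)

Lemma card_supersets (T : finType) (A : {set T}) m :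
  #|[set W : {set T} | (A \subset W) && (#|W| == m)]|
    = (if #|A| <= m then 'C(#|T| - #|A|, m - #|A|) else 0)%N.
Proof.
(* The guard matters: for [m < #|A|] the truncated difference is 0, and the bare binomial would be 1
   instead of 0. *)
case: leqP => [Am|mA]; last first.
  apply: eq_card0 => W; rewrite inE; apply/negP => /andP[/subset_leq_card AW /eqP Wm].
  by rewrite Wm leqNgt mA in AW.
have -> : (#|T| - #|A| = #|~: A|)%N by rewrite -(cardsC A) addKn.
rewrite -cards_draws -(card_in_imset (f := fun W => W :\: A)) => [|W W'].
  apply: eq_card => B; rewrite [RHS]inE; apply/imsetP/andP => [[W]|[BA /eqP Bm]].
    rewrite inE => /andP[AW /eqP Wm] ->; rewrite setDE subsetIr -setDE.
    by rewrite cardsD (setIidPr AW) Wm eqxx.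
  have dAB : A :&: B = set0.
    by apply/eqP; rewrite setI_eq0 disjoint_sym disjoints_subset.
  exists (A :|: B); last by rewrite setDUl setDv set0U setDE; apply/esym/setIidPl.
  by rewrite inE subsetUl cardsU dAB cards0 subn0 Bm subnKC ?eqxx.
rewrite !inE => /andP[AW _] /andP[AW' _] e.
by rewrite -(setID W A) -(setID W' A) e (setIidPr AW) (setIidPr AW').
Qed.

Lemma sum_card_supersets (J T : finType) (A : J -> {set T}) m p :
  (forall j, #|A j| = p) ->
  (\sum_(W : {set T} | #|W| == m) #|[set j | A j \subset W]|
    = #|J| * (if p <= m then 'C(#|T| - p, m - p) else 0))%N.
Proof.
move=> Ap; under eq_bigr do rewrite -sum1_card big_mkcond /=.
rewrite exchange_big /= -sum_nat_const; apply: eq_bigr => j _.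
rewrite -(Ap j) -card_supersets -sum1_card -big_mkcondr /=.
by apply: eq_bigl => W; rewrite !inE andbC.
Qed.

(** Absorption applied twice; it rewrites the arc count in terms of the binomial coefficient of the
    final formula. *)
Lemma bin_two n m : (n * n.-1 * 'C(n.-2, m) = m.+2 * m.+1 * 'C(n, m.+2))%N.
Proof. by rewrite -mulnA mul_bin_diag mulnCA mul_bin_diag mulnA [(m.+1 * _)%N]mulnC. Qed.

(** * Betti numbers by summation over the squarefree multidegrees *)

Section BettiCycleJoin.
Variables (K : fieldType) (d k : nat).
Hypotheses (k_gt1 : (1 < k)%N).
Local Notation V := ('I_d * 'I_k)%type.
Local Notation n := (d * k)%N.

Lemma card_joinV : #|{: V}| = n. Proof. by rewrite card_prod !card_ord. Qed.

Lemma sum_full m : (\sum_(W : {set V} | #|W| == m) #|full W|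
  = d * (if k <= m then 'C(n - k, m - k) else 0))%N.
Proof.
have := @sum_card_supersets _ _ (@copy d k) m k; rewrite card_ord card_joinV; apply => j.
have -> : copy k j = setX [set j] [set: 'I_k] by apply/setP=> -[a u]; rewrite !inE andbT.
by rewrite cardsX cards1 cardsT card_ord mul1n.
Qed.

Lemma sum_arcs m : (\sum_(W : {set V} | #|W| == m.+2) #|arcs W| = n * 'C(n.-2, m))%N.
Proof.
have aE W : arcs W = [set x : V | edge x \subset W].
  by apply/setP=> x; rewrite !inE subUset !sub1set.
under eq_bigr do rewrite aE.
rewrite (@sum_card_supersets _ _ _ _ 2%N) => [|x]; first by rewrite card_joinV subn2 !subSS subn0.
by rewrite cards2 eq_sym nxt_neq.
Qed.

Lemma betti_linear m : (betti K (joinG1 d k) m.+1 m.+2 + n * 'C(n.-2, m)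
  = m.+1 * 'C(n, m.+2) + d * (if k <= m.+2 then 'C(n - k, m.+2 - k) else 0))%N.
Proof.
rewrite betti_sum_sqfree -sum_arcs -big_split -sum_full /=.
rewrite [LHS](eq_bigr (fun W : {set V} => m.+1 + #|full W|)%N) => [|W /eqP cW]; last first.
  exact: khom_linear.
rewrite big_split /=; congr (_ + _)%N; rewrite -card_joinV -card_draws mulnC -sum_nat_const.
by apply: eq_bigl => W; rewrite inE.
Qed.

Lemma betti_second m : betti K (joinG1 d k) m.+1 m.+3
  = (if 4 <= k then d * (if k <= m.+3 then 'C(n - k, m.+3 - k) else 0) else 0)%N.
Proof.
rewrite betti_sum_sqfree -sum_full; case: leqP => k4.
  rewrite big1 // => W /eqP cW; have [k2|k2] := eqVneq k 2%N.
    exact: khom_second_k2.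
  by apply: khom_second_k3 => //; lia.
by apply: eq_bigr => W /eqP cW; apply: khom_second_k4.
Qed.
End BettiCycleJoin.

(** Matches the integer lower index of the theorem with the guarded natural subtraction of the
    counting lemmas. *)
Lemma binZ_sub N (a b : nat) (z : int) : z = a%:Z - b%:Z ->
  binZ N z = (if b <= a then 'C(N, a - b) else 0)%N.
Proof.
move=> ->; case: leqP => [ba|ab]; first by rewrite subzn.
have -> : a%:Z - b%:Z = Negz (b - a).-1 by lia.
by [].
Qed.

Unset Implicit Arguments.

Theorem theorem3p6 (K : fieldType) (k d i : nat) :
  (2 <= k)%N -> (2 <= d)%N -> (1 <= i)%N ->
  ((betti K (joinG1 d k) i i.+1)%:R : rat) =
    ('C(d * k, i.+1))%:R * (i%:R * ((d * k)%:R - i%:R - 2)) / ((d * k)%:R - 1)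
    + (d * binZ ((d - 1) * k) (i%:Z - k%:Z + 1))%:R
  /\
  betti K (joinG1 d k) i i.+2 =
    (if (4 <= k)%N then d * binZ ((d - 1) * k) (i%:Z - k%:Z + 2) else 0)%N.
Proof.
move=> k2 d2; case: i => [//|m] _.
rewrite (@binZ_sub _ m.+2 k) ?(@binZ_sub _ m.+3 k); [|lia|lia].
rewrite mulnBl mul1n; split; last exact: betti_second.
have := betti_linear K d k2 m; have := bin_two (d * k) m.
set S := (if _ then _ else _); set n := (d * k)%N; set b := betti _ _ _ _.
have n_gt1 : (1 < n)%N by rewrite /n; nia.
clearbody S b n => e1 e2; have n1 : n.-1%:R = n%:R - 1 :> rat by rewrite -subn1 natrB // ltnW.
have n0 : n%:R - 1 != 0 :> rat by rewrite -n1 pnatr_eq0; lia.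
have -> : b%:R = (m.+1 * 'C(n, m.+2))%:R + (d * S)%:R - (n * 'C(n.-2, m))%:R :> rat.
  by rewrite -natrD -e2 natrD addrK.
(* With [i = m.+1], the coefficient of the binomial becomes [i - i * (i + 1) / (n - 1)], which is
   [i * (n - i - 2) / (n - 1)]. *)
have -> : (n * 'C(n.-2, m))%:R = (m.+2 * m.+1 * 'C(n, m.+2))%:R / (n%:R - 1) :> rat.
  by rewrite -e1 !natrM n1; field.
by rewrite !natrM; field.
Qed.
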